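(* Let $p>2$ be an integer. The quandle $3$-cocycle of the dihedral quandle $R_p$ arising from the group $3$-cocycle $b_1b_2$ of $\mathbb{Z}/p$ (that is, the function $\Phi:R_p^3\to\mathbb{Z}/p$ constructed in the context) has the presentation $$(x,y,z)\longmapsto 2z\,\bigl(d(y-x,\,z-y)+d(y-x,\,y-z)\bigr)\qquad (x,y,z\in R_p).$$ This is a non-trivial quandle $3$-cocycle of $R_p$ with coefficients in $\mathbb{Z}/p$, i.e. it is a quandle $3$-cocycle whose class in $H^3_Q(R_p;\mathbb{Z}/p)$ is non-zero.
   Context: The dihedral quandle $R_p$ is the set $\mathbb{Z}/p$ with $x*y=2y-x \bmod p$. Quandle cohomology with coefficients in an abelian group $A$: for a quandle $(X,* )$, let $C^R_n(X)$ be the free abelian group on $X^n$ with boundary $$\partial(x_1,\dots,x_n)=\sum_{i=1}^n(-1)^i\bigl((x_1,\dots,\widehat{x_i},\dots,x_n)-(x_1*x_i,\dots,x_{i-1}*x_i,x_{i+1},\dots,x_n)\bigr),$$ let $C^D_n(X)$ be the subcomplex generated by the tuples with $x_i=x_{i+1}$ for some $i$, and let $C^Q_n(X)=C^R_n(X)/C^D_n(X)$. $H_Q^n(X;A)$ is the cohomology of $\mathrm{Hom}(C^Q_*(X),A)$; a quandle $n$-cocycle is a function $X^n\to A$ that defines a cocycle of this complex. Group cocycles: for $x\in\mathbb{Z}/p$ let $\overline{x}$ be the integer with $0\le\overline{x}<p$ and $\overline{x}\equiv x$. Let $b_1(x)=x$ and $b_2(x,y)=\frac1p(\overline{y}-\overline{x+y}+\overline{x})\in\mathbb{Z}/p$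 (so $b_2(x,y)=1$ if $\overline{x}+\overline{y}\ge p$ and $0$ otherwise). The product $b_1b_2$ is the normalized $3$-cocycle $[x|y|z]\mapsto b_1(x)\,b_2(y,z)$ of $\mathbb{Z}/p$ with $\mathbb{Z}/p$ coefficients; in homogeneous form it is $f(x_0,x_1,x_2,x_3)=b_1(x_1-x_0)\,b_2(x_2-x_1,x_3-x_2)$. Put $$d(x,y)=b_2(x,y)-b_2(-x,-y)\in\mathbb{Z}/p,$$ equivalently $d(x,y)=1$ if $\overline{x}+\overline{y}>p$; $d(x,y)=-1$ if $\overline{x}+\overline{y}<p$, $x\neq0$ and $y\neq0$; $d(x,y)=0$ otherwise. Construction of the quandle cocycle: let $\tilde f(x_0,x_1,x_2,x_3)=f(x_0,x_1,x_2,x_3)+f(-x_0,-x_1,-x_2,-x_3)$. Fix $q=0\in R_p$ and put $$\Phi(r,x,y)=\tilde f(q,r,x,y)-\tilde f(q,r*x,x,y)-\tilde f(q,r*y,x*y,y)+\tilde f(q,(r*x)*y,x*y,y).$$ (In general $q$ is an arbitrary fixed element of $R_p$, and changing $q$ changes the cocycle only by a coboundary.)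
   Formalization: Non-triviality is stated only for p ≠ 4: for p = 4 the claim is false, since the cocycle equals 2·[x odd][y even][z odd], the coboundary of the 2-cochain g(x,y) = 2·[x, y odd, x ≠ y]. The presentation and the cocycle property are kept for all p > 2. *)

(* Defs.v *)
From HB Require Import structures.
From mathcomp Require Import all_boot all_order all_algebra.
From mathcomp Require Import freeg ring.
Set Implicit Arguments.
Unset Strict Implicit.
Unset Printing Implicit Defensive.
Import GRing.Theory.
Local Open Scope ring_scope.

HB.mixin Record isQuandle X of Choice X := {
  qop : X -> X -> X;
  qopxx : forall x, qop x x = x;
  qop_bij : forall y, bijective (fun x => qop x y);
  qop_distr : forall x y z, qop (qop x y) z = qop (qop x z) (qop y z)
}.

#[short(type="quandleType")]
HB.structure Definition Quandle := { X of Choice X & isQuandle X }.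

Section QuandleCohomology.
Variables (X : quandleType) (A : zmodType).

Notation rack_chain n := {freeg (n.-tuple X) / int}.

(* (x_1, .., x_i omitted, .., x_n); positions are numbered from 0 here. *)
Definition face0 n (i : 'I_n.+1) (t : n.+1.-tuple X) : n.-tuple X :=
  [tuple tnth t (fintype.lift i j) | j < n].

(* (x_1 * x_i, .., x_(i-1) * x_i, x_(i+1), .., x_n) *)
Definition face1 n (i : 'I_n.+1) (t : n.+1.-tuple X) : n.-tuple X :=
  [tuple if (j < i)%N then qop (tnth t (fintype.lift i j)) (tnth t i)
         else tnth t (fintype.lift i j) | j < n].

(* The exponent is i.+1 because i : 'I_n.+1 is the (i.+1)-st position. *)
Definition rack_boundary_gen n (t : n.+1.-tuple X) : rack_chain n :=
  \sum_(i < n.+1) (-1) ^+ i.+1 *: (<< face0 i t >> - << face1 i t >>).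

Definition rack_boundary n (c : rack_chain n.+1) : rack_chain n :=
  fglift (@rack_boundary_gen n) c.

HB.instance Definition _ n := GRing.isZmodMorphism.Build
  (rack_chain n.+1) (rack_chain n) (@rack_boundary n) (lift_is_additive _).

Definition degenerate n (t : n.-tuple X) : bool :=
  [exists i : 'I_n, exists j : 'I_n, (j == i.+1 :> nat) && (tnth t i == tnth t j)].

(* C^D_n: the subgroup spanned by the degenerate tuples, i.e. the chains
   supported on them. *)
Definition degenerate_chain n (c : rack_chain n) : bool :=
  all (@degenerate n) (dom c).

(* The additive map C^R_n -> A with values f on the basis X^n;
   zmodule A is A viewed as a module over int. *)
Definition cochain_eval n (f : n.-tuple X -> A) (c : rack_chain n) : A :=
  fglift (f : n.-tuple X -> zmodule A) c.

HB.instance Definition _ n f := GRing.isZmodMorphism.Build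
  (rack_chain n) A (@cochain_eval n f)
  (lift_is_additive (f : n.-tuple X -> zmodule A)).

(* f induces an element of Hom(C^Q_n, A) = Hom(C^R_n / C^D_n, A). *)
Definition quandle_cochain n (f : n.-tuple X -> A) : Prop :=
  forall c : rack_chain n, degenerate_chain c -> cochain_eval f c = 0.

Definition quandle_cocycle n (f : n.-tuple X -> A) : Prop :=
  quandle_cochain f /\
  forall c : rack_chain n.+1, cochain_eval f (rack_boundary c) = 0.

(* f is zero in H_Q^(n+1)(X; A), for f a cocycle. *)
Definition quandle_coboundary n (f : n.+1.-tuple X -> A) : Prop :=
  exists g : n.-tuple X -> A, quandle_cochain g /\
    forall c : rack_chain n.+1,
      cochain_eval f c = cochain_eval g (rack_boundary c).

Definition cochain3 (f : X -> X -> X -> A) : 3.-tuple X -> A :=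
  fun t => f [tnth t 0] [tnth t 1] [tnth t 2].

End QuandleCohomology.

(* 'Z_p is Z/p only for p > 1. *)
Definition dihedral_op (p : nat) (x y : 'Z_p) : 'Z_p := 2%:R * y - x.

Definition dihedral (p : nat) : Type := 'Z_p.

HB.instance Definition _ p := Choice.copy (dihedral p) 'Z_p.

Section DihedralQuandle.
Variable p : nat.

Lemma dihedral_opxx (x : 'Z_p) : dihedral_op x x = x.
Proof. by rewrite /dihedral_op mulr_natl mulr2n addrK. Qed.

Lemma dihedral_opK (y : 'Z_p) : involutive (fun x => dihedral_op x y).
Proof. by move=> x; rewrite /dihedral_op opprB addrC subrK. Qed.

Lemma dihedral_op_distr (x y z : 'Z_p) :
  dihedral_op (dihedral_op x y) z =
  dihedral_op (dihedral_op x z) (dihedral_op y z).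
Proof. by rewrite /dihedral_op; ring. Qed.

HB.instance Definition _ := isQuandle.Build (dihedral p)
  dihedral_opxx (fun y => inv_bij (@dihedral_opK y)) dihedral_op_distr.

End DihedralQuandle.

Section GroupCocycle.
Variable p : nat.

Definition b1 (x : 'Z_p) : 'Z_p := x.

(* The coercion 'Z_p -> nat gives the representative in [0, p); the division
   by p is exact. *)
Definition b2 (x y : 'Z_p) : 'Z_p :=
  (((y : nat)%:Z - ((x + y)%R : nat)%:Z + (x : nat)%:Z) %/ p%:Z)%Z%:~R.

Definition b1b2 (x y z : 'Z_p) : 'Z_p := b1 x * b2 y z.

Definition hom_b1b2 (x0 x1 x2 x3 : 'Z_p) : 'Z_p :=
  b1b2 (x1 - x0) (x2 - x1) (x3 - x2).

Definition sym_b1b2 (x0 x1 x2 x3 : 'Z_p) : 'Z_p :=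
  hom_b1b2 x0 x1 x2 x3 + hom_b1b2 (- x0) (- x1) (- x2) (- x3).

Definition Phi (q r x y : 'Z_p) : 'Z_p :=
  sym_b1b2 q r x y
  - sym_b1b2 q (dihedral_op r x) x y
  - sym_b1b2 q (dihedral_op r y) (dihedral_op x y) y
  + sym_b1b2 q (dihedral_op (dihedral_op r x) y) (dihedral_op x y) y.

Definition d (x y : 'Z_p) : 'Z_p := b2 x y - b2 (- x) (- y).

End GroupCocycle.

Section EvalLemmas.
Variables (X : quandleType) (A : zmodType).

Lemma cochain_evalU n (f : n.-tuple X -> A) (k : int) t :
  cochain_eval f << k *g t >> = f t *~ k.
Proof. exact: (liftU (f : _ -> zmodule A) k t). Qed.

Lemma rack_boundaryU n (k : int) (t : n.+1.-tuple X) :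
  rack_boundary << k *g t >> = k *: rack_boundary_gen t.
Proof. exact: (liftU _ k t). Qed.

Lemma cochain_eval_sum n (f : n.-tuple X -> A) c :
  cochain_eval f c = \sum_(t <- dom c) f t *~ coeff t c.
Proof.
rewrite -{1}[c]freeg_sumE raddf_sum.
by apply: eq_bigr => t _; exact: cochain_evalU.
Qed.

Lemma rack_boundary_sum n (c : {freeg (n.+1.-tuple X) / int}) :
  rack_boundary c = \sum_(t <- dom c) coeff t c *: rack_boundary_gen t.
Proof.
rewrite -{1}[c]freeg_sumE raddf_sum.
by apply: eq_bigr => t _; exact: rack_boundaryU.
Qed.

Lemma cochain_eval_boundary n (g : n.-tuple X -> A) c :
  cochain_eval g (rack_boundary c) =
  \sum_(t <- dom c)
     (\sum_(i < n.+1) (g (face0 i t) - g (face1 i t)) *~ (-1) ^+ i.+1)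
        *~ coeff t c.
Proof.
have evZ (k : int) (e : {freeg (n.-tuple X) / int}) :
  cochain_eval g (k *: e) = cochain_eval g e *~ k.
  by rewrite -[k in LHS]intz scaler_int raddfMz.
rewrite rack_boundary_sum raddf_sum; apply: eq_bigr => t _.
rewrite [LHS]evZ; congr (_ *~ _); rewrite raddf_sum.
apply: eq_bigr => i _; rewrite [LHS]evZ; congr (_ *~ _).
by rewrite raddfB; congr (_ - _); exact: (cochain_evalU g 1).
Qed.
End EvalLemmas.

(* R_4 is exceptional: the pairing of the cocycle with the quandle cycle
   \sum_i (0, i, i+1) is -4, which is zero in Z/p for p = 4 and for no other
   p > 2; and for p = 4 the cocycle is indeed a coboundary. *)
Lemma dihedral4_coboundary :
  quandle_coboundary (@cochain3 (dihedral 4) 'Z_4 (Phi 0)).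
Proof.
pose h (x y : 'Z_4) : 'Z_4 :=
  if [&& odd x, odd y & x != y] then 2%:R else 0.
exists (fun t : 2.-tuple (dihedral 4) => h [tnth t 0] [tnth t 1]); split=> [c /allP hc|c].
  rewrite cochain_eval_sum big_seq big1 // => t /hc /existsP[i /existsP[j]].
  case: t i j => [[|x [|y [|? ?]]]] // ht.
  move=> [[|[|//]] hi] [[|[|//]] hj] //= /eqP; rewrite !(tnth_nth x) /= => ->.
  by rewrite /h eqxx !andbF mul0rz.
rewrite cochain_eval_sum cochain_eval_boundary; apply: eq_bigr => t _.
congr (_ *~ _); rewrite !big_ord_recl big_ord0 /cochain3 !tnth_mktuple.
case: t => [[|x [|y [|z [|? ?]]]]] //= ht.
rewrite !(tnth_nth x) /=.
have P : forall x y z : 'Z_4, Phi 0 x y z ==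
  (h y z - h y z) *~ (-1) ^+ 1 +
  ((h x z - h (dihedral_op x y) z) *~ (-1) ^+ 2 +
   ((h x y - h (dihedral_op x z) (dihedral_op y z)) *~ (-1) ^+ 3 + 0)).
  by move=> [[|[|[|[|//]]]] ?] [[|[|[|[|//]]]] ?] [[|[|[|[|//]]]] ?]; vm_compute.
by move=> *; exact/eqP/P.
Qed.

(* Main.v *)
Require Import Defs.
From mathcomp Require Import all_boot all_order all_algebra.
From mathcomp Require Import freeg ring zify.
Set Implicit Arguments.
Unset Strict Implicit.
Unset Printing Implicit Defensive.
Import GRing.Theory.
Local Open Scope ring_scope.

(** The function [b2] is the carry of addition modulo [p]: it is the group
    [2]-cocycle of the extension [Z/p -> Z/p^2 -> Z/p]. Its odd part [d] is
    therefore again a [2]-cocycle. The presentation of [Phi] and its cocycle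
    property use only that [d] is odd, vanishes when an argument is [0], and
    satisfies the cocycle identity; non-triviality uses the values [d x 1] and
    [d x (-1)].

    Presentation. Put [a = y - x] and [b = z - y]. Each of the four terms of
    [Phi 0 x y z] is a multiple of some [d (+-a) (+-b)], and oddness leaves only
    [d a b] and [d a (- b)], both with coefficient [2 z].

    Cocycle. Write [e a b = d a b + d a (- b)], which is odd in [a] and even
    in [b]. Since right translations of the dihedral quandle are reflections,
    the coboundary of [Phi 0] at [(x, y, z, w)], with [c = w - z], is [2 w] times
    [e (a + b) c + e (a - b) c - e a (b + c) - e a (c - b) + 2 e a b]; this is zero
    by four instances of the cocycle identity for [d] ([d_symm_cocycle]).

    Non-triviality. The sum of the triples [(0, i, i + 1)] over all [i] in [Z/p]
    is a cycle: its boundary telescopes around [Z/p], so every coboundary sums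
    to zero over these triples ([coboundary_cycle_sum]). On this cycle [Phi 0]
    takes the value [-4], because [e i 1] is [1] at [i = -1], where the factor
    [i + 1] vanishes, [-1] at [i = 1], and [0] elsewhere. For [p > 2], [p] divides
    [4] only if [p = 4]. *)

(** * Quandle cochains on basis tuples *)

Section Cochains.
Variables (X : quandleType) (A : zmodType).

Lemma cochain_eval_basis n (f : n.-tuple X -> A) t :
  cochain_eval f << t >> = f t.
Proof. by rewrite cochain_evalU mulr1z. Qed.

Definition coboundary n (f : n.-tuple X -> A) (t : n.+1.-tuple X) : A :=
  \sum_(i < n.+1) (f (face0 i t) - f (face1 i t)) *~ (-1) ^+ i.+1.

Lemma cochain_eval_coboundary n (f : n.-tuple X -> A) c :
  cochain_eval f (rack_boundary c) = cochain_eval (coboundary f) c.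
Proof. by rewrite cochain_eval_boundary cochain_eval_sum. Qed.

Lemma quandle_cocycle_basis n (f : n.-tuple X -> A) :
    (forall t, degenerate t -> f t = 0) -> (forall t, coboundary f t = 0) ->
  quandle_cocycle f.
Proof.
move=> f_deg df0; split=> [c /allP c_deg|c].
  rewrite cochain_eval_sum big_seq big1 // => t /c_deg t_deg.
  by rewrite f_deg ?mul0rz.
rewrite cochain_eval_coboundary cochain_eval_sum big1 // => t _.
by rewrite df0 mul0rz.
Qed.

Lemma quandle_coboundary_basis n (f : n.+1.-tuple X -> A) :
  quandle_coboundary f -> exists g : n.-tuple X -> A, f =1 coboundary g.
Proof.
case=> g [_ fE]; exists g => t.
by rewrite -[LHS]cochain_eval_basis fE cochain_eval_coboundary cochain_eval_basis.
Qed.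

Lemma degenerate_cochain3 (f : X -> X -> X -> A) :
    (forall x z, f x x z = 0) -> (forall x y, f x y y = 0) ->
  forall t, degenerate t -> cochain3 f t = 0.
Proof.
move=> fxx fyy [[|x [|y [|z [|? ?]]]] // ht] /existsP[i /existsP[j]].
case: i j => [[|[|[|//]]] hi] [[|[|[|//]]] hj] //= /eqP.
  by rewrite /cochain3 !(tnth_nth x) /= => ->.
by rewrite /cochain3 !(tnth_nth x) /= => ->.
Qed.

Lemma coboundary_cochain3 (f : X -> X -> X -> A) (t : 4.-tuple X) :
  let x := [tnth t 0] in let y := [tnth t 1] in
  let z := [tnth t 2] in let w := [tnth t 3] in
  coboundary (cochain3 f) t =
    f x z w - f (qop x y) z w
    - (f x y w - f (qop x z) (qop y z) w)
    + (f x y z - f (qop x w) (qop y w) (qop z w)).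
Proof.
case: t => [[|x [|y [|z [|w [|? ?]]]]]] //= ht.
rewrite /coboundary !big_ord_recl big_ord0 /cochain3 !tnth_mktuple.
rewrite !(tnth_nth x) /= subrr mul0rz add0r addr0 addrA.
have -> : (-1) ^+ 2 = 1 :> int by []; have -> : (-1) ^+ 3 = -1 :> int by [].
by have -> : (-1) ^+ 4 = 1 :> int by []; rewrite !mulr1z mulrN1z.
Qed.

Lemma coboundary2 (g : 2.-tuple X -> A) x y z :
  coboundary g [tuple x; y; z] =
    g [tuple x; z] - g [tuple qop x y; z]
    - (g [tuple x; y] - g [tuple qop x z; qop y z]).
Proof.
rewrite /coboundary !big_ord_recl big_ord0 addr0.
have -> : face0 ord0 [tuple x; y; z] = face1 ord0 [tuple x; y; z].
  by apply: eq_from_tnth => i; rewrite !tnth_mktuple.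
rewrite subrr mul0rz add0r /=.
have -> : (-1) ^+ 2 = 1 :> int by []; have -> : (-1) ^+ 3 = -1 :> int by [].
rewrite mulr1z mulrN1z.
by congr (g _ - g _ - (g _ - g _)); apply: eq_from_tnth => -[[|[|//]] hi];
   rewrite tnth_mktuple !(tnth_nth x).
Qed.

End Cochains.

(** * The carry cocycle of Z/p *)

Section Carry.
Variables (p : nat) (p_gt1 : (1 < p)%N).
Implicit Types x y z : 'Z_p.

Lemma Zp_valD x y : val (x + y) = ((x + y) %% p)%N.
Proof. by case: p p_gt1 x y => [|[|n]]. Qed.

Lemma b2_carry x y : b2 x y = ((x + y) %/ p)%:R.
Proof.
rewrite /b2 [nat_of_ord (x + y)%R]Zp_valD.
have -> : (y : nat)%:Z - ((x + y) %% p)%:Z + (x : nat)%:Z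
    = ((x + y) %/ p)%:Z * p%:Z.
  have /(congr1 Posz) := divn_eq (x + y) p.
  by rewrite !PoszD PoszM => xyE; rewrite addrAC [y%:Z + _]addrC xyE addrK.
by rewrite mulzK //; apply/eqP; lia.
Qed.

(** Both sides count how many multiples of [p] are lost in adding the three
    representatives. *)
Lemma b2_cocycle x y z : b2 x y + b2 (x + y) z = b2 y z + b2 x (y + z).
Proof.
rewrite !b2_carry -!natrD !Zp_valD; congr _%:R.
have p_gt0 : (0 < p)%N by exact: ltnW.
rewrite -!divnMDl // addnA -divn_eq [in RHS]addnCA -divn_eq.
by rewrite addnA.
Qed.

Lemma b2x0 x : b2 x 0 = 0.
Proof.
rewrite b2_carry addn0 divn_small //.
by case: p p_gt1 x => [|[|n]] // _ x; exact: ltn_ord.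
Qed.

Lemma b20x x : b2 0 x = 0.
Proof.
rewrite b2_carry add0n divn_small //.
by case: p p_gt1 x => [|[|n]] // _ x; exact: ltn_ord.
Qed.

Lemma b2x1 x : b2 x 1 = (x == -1)%:R.
Proof.
rewrite b2_carry; congr (_%:R).
case: p p_gt1 x => [|[|n]] // _ x.
have x_lt : (x < n.+2)%N := ltn_ord x.
have -> : (x == -1) = (x == n.+1 :> nat).
  by rewrite -val_eqE /= modn_small ?subn1.
have [->|xN] := eqVneq (x : nat) n.+1; first by rewrite addn1 divnn.
by rewrite addn1 divn_small //; lia.
Qed.

Lemma b2xN1 x : b2 x (-1) = (x != 0)%:R.
Proof.
rewrite b2_carry; congr (_%:R).
case: p p_gt1 x => [|[|n]] // _ x.
have x_lt : (x < n.+2)%N := ltn_ord x.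
have -> : nat_of_ord (-1 : 'Z_n.+2) = n.+1 by rewrite /= modn_small ?subn1.
rewrite -val_eqE /=; have [->|xN] := eqVneq (x : nat) 0%N.
  by rewrite add0n divn_small.
have -> : (x + n.+1 = 1 * n.+2 + x.-1)%N by lia.
by rewrite divnMDl // divn_small //; lia.
Qed.

Lemma dNN x y : d (- x) (- y) = - d x y.
Proof. by rewrite /d !opprK opprB. Qed.

Lemma dx0 x : d x 0 = 0.
Proof. by rewrite /d oppr0 !b2x0 subrr. Qed.

Lemma d0x x : d 0 x = 0.
Proof. by rewrite /d oppr0 !b20x subrr. Qed.

Lemma d_cocycle x y z : d x y + d (x + y) z = d y z + d x (y + z).
Proof.
have E1 := b2_cocycle x y z; have E2 := b2_cocycle (- x) (- y) (- z).
by rewrite -!opprD in E2; rewrite /d addrACA [RHS]addrACA -!opprD E1 E2.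
Qed.

(** The carries [b2 x (-1)] and [b2 (- x) (-1)] are both the indicator of
    [x != 0], and cancel in this sum. *)
Lemma d_symm1 x : d x 1 + d x (-1) = (x == -1)%:R - (x == 1)%:R.
Proof.
by rewrite /d opprK !b2x1 !b2xN1 oppr_eq0 eqr_opp addrA subrK.
Qed.

(** The cocycle identity for the four triples [(x, +-y, +-z)]: oddness cancels
    the terms [d (+-y) (+-z)] against each other. *)
Lemma d_symm_cocycle x y z :
  d (x + y) z + d (x + y) (- z) + (d (x - y) z + d (x - y) (- z))
  + (d x y + d x (- y)) *+ 2 =
  d x (y + z) + d x (- (y + z)) + (d x (z - y) + d x (y - z)).
Proof.
have E1 := d_cocycle x y z; have E2 := d_cocycle x y (- z).
have E3 := d_cocycle x (- y) z; have E4 := d_cocycle x (- y) (- z).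
have O1 := dNN y z; have O2 := dNN y (- z); rewrite opprK in O2.
have -> : d (x + y) z = d y z + d x (y + z) - d x y by rewrite -E1; ring.
have -> : d (x + y) (- z) = d y (- z) + d x (y - z) - d x y by rewrite -E2; ring.
have -> : d (x - y) z = - d y (- z) + d x (z - y) - d x (- y).
  by rewrite -O2 [z - y]addrC -E3; ring.
have -> : d (x - y) (- z) = - d y z + d x (- (y + z)) - d x (- y).
  by rewrite -O1 opprD -E4; ring.
by ring.
Qed.

End Carry.

(** * The cocycle of the dihedral quandle *)

Lemma Phi_presentation p (x y z : 'Z_p) :
  Phi 0 x y z = 2%:R * z * (d (y - x) (z - y) + d (y - x) (y - z)).
Proof.
have symE (x0 x1 x2 x3 : 'Z_p) :
    sym_b1b2 x0 x1 x2 x3 = (x1 - x0) * d (x2 - x1) (x3 - x2).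
  rewrite /sym_b1b2 /hom_b1b2 /b1b2 /b1 /d.
  have -> : - x2 - - x1 = - (x2 - x1) by ring.
  have -> : - x3 - - x2 = - (x3 - x2) by ring.
  by ring.
rewrite /Phi !symE /dihedral_op.
have -> : y - (2%:R * y - x) = - (y - x) by ring.
have -> : 2%:R * z - y - (2%:R * z - x) = - (y - x) by ring.
have -> : z - (2%:R * z - y) = - (z - y) by ring.
have -> : 2%:R * z - y - (2%:R * z - (2%:R * y - x)) = y - x by ring.
have -> : d (- (y - x)) (z - y) = - d (y - x) (y - z).
  by rewrite -[z - y]opprB dNN.
by rewrite dNN [- (z - y)]opprB; ring.
Qed.

Lemma Phi_cocycle p : (1 < p)%N ->
  quandle_cocycle (@cochain3 (dihedral p) 'Z_p (Phi 0)).
Proof.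
move=> p_gt1; apply: quandle_cocycle_basis => [|t].
  apply: degenerate_cochain3 => x y; rewrite Phi_presentation subrr.
    by rewrite !d0x // addr0 mulr0.
  by rewrite !dx0 // addr0 mulr0.
rewrite coboundary_cochain3.
move: [tnth t 0] [tnth t 1] [tnth t 2] [tnth t 3] => x y z w /=.
rewrite /qop /= /dihedral_op.
have PhiE (x1 x2 x3 a b : 'Z_p) : x2 - x1 = a -> x3 - x2 = b ->
    Phi 0 x1 x2 x3 = 2%:R * x3 * (d a b + d a (- b)).
  by move=> <- <-; rewrite Phi_presentation opprB.
have PhiNE (x1 x2 x3 a b : 'Z_p) : x2 - x1 = - a -> x3 - x2 = b ->
    Phi 0 x1 x2 x3 = - (2%:R * x3 * (d a b + d a (- b))).
  move=> a21 /(PhiE _ _ _ _ _ a21) ->.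
  have -> : d (- a) b = - d a (- b) by rewrite -dNN opprK.
  by rewrite dNN; ring.
pose a : 'Z_p := y - x; pose b : 'Z_p := z - y; pose c : 'Z_p := w - z.
rewrite (PhiE x z w (a + b) c) ?(PhiNE _ z w (a - b) c);
  try by rewrite /a /b /c; ring.
rewrite (PhiE x y w a (b + c)); try by rewrite /a /b /c; ring.
rewrite (PhiNE _ _ w a (c - b)); try by rewrite /a /b /c; ring.
(* Right translation by [w] turns [(a, b)] into [(- a, - b)]. *)
rewrite (PhiE x y z a b) ?(PhiNE _ _ _ a (- b)); try by rewrite /a /b /c; ring.
have /eqP := d_symm_cocycle p_gt1 a b c; rewrite -subr_eq0 => /eqP symE.
by rewrite [- - b]opprK [- (c - b)]opprB -[RHS](mulr0 (2%:R * w)) -symE; ring.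
Qed.

(** The coboundary at [(0, i, i + 1)] is [u (i + 1) - u i + (v (i + 1) - v i)],
    where [u i] and [v i] are the values of [g] at [(0, i)] and [(2 i, i + 1)]:
    right translation by [i + 1] maps [(0, i)] to [(2 (i + 1), i + 2)]. Both
    differences telescope around [Z/p]. *)
Lemma coboundary_cycle_sum p (A : zmodType) (g : 2.-tuple (dihedral p) -> A) :
  \sum_(i : 'Z_p) coboundary g [tuple (0 : 'Z_p); i; i + 1] = 0.
Proof.
pose u (i : 'Z_p) := g [tuple (0 : 'Z_p); i].
pose v (i : 'Z_p) := g [tuple 2%:R * i; i + 1].
have shift (h : 'Z_p -> A) : \sum_i h (i + 1) = \sum_i h i.
  by rewrite [RHS](reindex_inj (addIr 1)).
under eq_bigr => i _.
  rewrite coboundary2.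
  have -> : [tuple qop (0 : dihedral p) (i + 1 : 'Z_p);
                   qop (i : dihedral p) (i + 1 : 'Z_p)]
       = [tuple 2%:R * (i + 1) : 'Z_p; i + 1 + 1] :> 2.-tuple (dihedral p).
    by apply: val_inj; congr [:: _; _]; rewrite /qop /= /dihedral_op; ring.
  have -> : qop (0 : dihedral p) (i : dihedral p) = 2%:R * i :> 'Z_p.
    by rewrite /qop /= /dihedral_op subr0.
  rewrite -/(u (i + 1)) -/(u i) -/(v i) -/(v (i + 1)).
  over.
by rewrite !sumrB !shift subrr.
Qed.

(** By [d_symm1] only [i = 1] and [i = -1] can contribute; the factor [i + 1]
    kills the latter. *)
Lemma Phi_cycle_sum p : (2 < p)%N ->
  \sum_(i : 'Z_p) Phi 0 0 i (i + 1) = - 4%:R.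
Proof.
move=> p_gt2; have p_gt1 := ltnW p_gt2.
have N1neq1 : (-1 : 'Z_p) != 1.
  by case: p p_gt2 {p_gt1} => [|[|[|n]]] // _; rewrite -val_eqE /= modn_small.
have PhiE (i : 'Z_p) : Phi 0 0 i (i + 1)
    = 2%:R * (i + 1) * ((i == -1)%:R - (i == 1)%:R).
  rewrite Phi_presentation -(d_symm1 p_gt1).
  have -> : i + 1 - i = 1 by ring.
  have -> : i - (i + 1) = -1 by ring.
  by rewrite subr0.
under eq_bigr => i _ do rewrite PhiE.
rewrite (bigD1 1) // big1 => [|i iN1]; last first.
  rewrite (negPf iN1); have [->|_] := eqVneq i (-1); last by rewrite subrr mulr0.
  by rewrite addrC subrr mulr0 mul0r.
by rewrite eqxx eq_sym (negPf N1neq1) [LHS]addr0 mulr0n mulr1n; ring.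
Qed.

Lemma Phi_not_coboundary p : (2 < p)%N -> p <> 4 ->
  ~ quandle_coboundary (@cochain3 (dihedral p) 'Z_p (Phi 0)).
Proof.
move=> p_gt2 p_neq4 /quandle_coboundary_basis[g PhiE].
have : \sum_(i : 'Z_p) Phi 0 0 i (i + 1) = 0 :> 'Z_p.
  rewrite -[RHS](coboundary_cycle_sum g); apply: eq_bigr => i _.
  by rewrite -PhiE.
rewrite Phi_cycle_sum // => /eqP; rewrite oppr_eq0 => /eqP.
move/(congr1 (@nat_of_ord _)); rewrite val_Zp_nat ?(ltnW p_gt2) // => p_dvd4.
case: p p_gt2 p_neq4 p_dvd4 {g PhiE} => [|[|[|[|[|p]]]]] //.
Qed.

Theorem proposition7p1 (p : nat) (hp : (2 < p)%N) :
  (forall x y z : 'Z_p,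
     Phi 0 x y z = 2%:R * z * (d (y - x) (z - y) + d (y - x) (y - z))) /\
  quandle_cocycle (@cochain3 (dihedral p) 'Z_p (Phi 0)) /\
  (p <> 4%N -> ~ quandle_coboundary (@cochain3 (dihedral p) 'Z_p (Phi 0))).
Proof.
split; first exact: Phi_presentation.
split; first exact/Phi_cocycle/ltnW.
exact: Phi_not_coboundary.
Qed.
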